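(* Let $K$ be a field with an ordering $<$ such that each positive element of $K$ is a square in $K$. Let $L:=K(i)$ with $i^2=-1$, and let $\sigma:L\to L$ be the $K$-automorphism induced by $i\mapsto -i$. Let $n\ge 1$, let $M\in M_{n,n}(K)$ and let $a,b\in\mathrm{Num}(M)$ with $a\ne b$. Then there is $S\subseteq\mathrm{Num}(M)$ such that $a\in S$, $b\in S$ and $S$ is either the $\Delta$-convex hull of $\{a,b\}$ or, up to an affine transformation of $L$, a $\Delta$-ellipse with two foci (i.e. there are $e,f\in L$ with $f\ne 0$ such that $(S-e)/f$ is a $\Delta$-ellipse with two foci).
   Context: $M_{n,n}(F)$ is the set of $n\times n$ matrices over a field $F$; a matrix over $K$ is regarded as a matrix over $L$. For $u,v\in L^n$ set $\langle u,v\rangle:=\sum_{i=1}^n\sigma(u_i)v_i$. The numerical range of $M\in M_{n,n}(L)$ is $\mathrm{Num}(M):=\{\langle u,Mu\rangle \mid u\in L^n,\ \langle u,u\rangle=1\}\subseteq L$ (vectors $u$ range over $L^n$). $\Delta:=\{a\sigma(a)\mid a\in L\}\subseteq K$ and $1-\Delta:=\{1-s\mid s\in\Delta\}$. The $\Delta$-convex hull of $\{a,b\}$, $a\ne b$, is $\{ta+(1-t)b\mid t\in\Delta\cap(1-\Delta)\}$. A $\Delta$-ellipse with two foci is a subset of $L$ of the form $\{d_1y\sigma(x)+d_2y\sigma(y)\mid (x,y)\in L^2,\ \delta_1x\sigma(x)+\delta_2y\sigma(y)=1\}$ for some $\delta_1,\delta_2\in\Delta\setminus\{0\}$ and $d_1,d_2\in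 L\setminus\{0\}$. *)

(* Defs.v *)
From HB Require Import structures.
From mathcomp Require Import all_boot all_order all_algebra.
From mathcomp Require Import complex.
From mathcomp Require Import mathcomp_extra boolp classical_sets.

Set Implicit Arguments.
Unset Strict Implicit.
Unset Printing Implicit Defensive.

Import Order.TTheory GRing.Theory Num.Theory.

Local Open Scope classical_set_scope.
Local Open Scope ring_scope.

(* L = K(i) is the library's K[i], sigma is conjc, and the inclusion of K in
   L is real_complex K. *)

Definition hform (K : realFieldType) (n : nat) (u v : 'cV[K[i]]_n) : K[i] :=
  \sum_(j < n) conjc (u j 0) * v j 0.

Definition numrange (K : realFieldType) (n : nat) (M : 'M[K[i]]_n) :
    set K[i] :=
  [set hform u (M *m u) | u in [set u : 'cV[K[i]]_n | hform u u = 1]].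

(* A matrix over K regarded as a matrix over L. *)
Definition mxL (K : realFieldType) (n : nat) (M : 'M[K]_n) : 'M[K[i]]_n :=
  map_mx (real_complex K) M.

(* Delta is encoded as a subset of L; it is contained in K by Delta_sub. *)
Definition Delta (K : realFieldType) : set K[i] :=
  [set a * conjc a | a in [set: K[i]]].
Arguments Delta K _ : clear implicits.

Definition oneBDelta (K : realFieldType) : set K[i] :=
  [set 1 - s | s in Delta K].
Arguments oneBDelta K _ : clear implicits.

Lemma Delta_sub (K : realFieldType) : Delta K `<=` range (real_complex K).
Proof.
move=> _ [[x y] _ <-]; exists (x ^+ 2 + y ^+ 2) => //.
apply/eqP; rewrite eq_complex /= mulrN opprK !expr2 eqxx /=.
by rewrite mulrN [y * x]mulrC addNr.
Qed.

(* Meant for a != b. *)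
Definition Delta_hull (K : realFieldType) (a b : K[i]) : set K[i] :=
  [set t * a + (1 - t) * b | t in Delta K `&` oneBDelta K].

Definition Delta_ellipse_set (K : realFieldType) (delta1 delta2 d1 d2 : K[i]) :
    set K[i] :=
  [set d1 * z.2 * conjc z.1 + d2 * z.2 * conjc z.2 | z in
    [set z : K[i] * K[i] |
      delta1 * z.1 * conjc z.1 + delta2 * z.2 * conjc z.2 = 1]].

Definition is_Delta_ellipse (K : realFieldType) (S : set K[i]) : Prop :=
  exists delta1 delta2 d1 d2 : K[i],
    [/\ (Delta K `\ 0) delta1, (Delta K `\ 0) delta2, d1 != 0, d2 != 0 &
        S = Delta_ellipse_set delta1 delta2 d1 d2].

(* Main.v *)
Require Import Defs.
From mathcomp Require Import all_boot all_order all_algebra.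
From mathcomp Require Import complex.
From mathcomp Require Import mathcomp_extra boolp classical_sets.
From mathcomp Require Import ring.
Import Order.TTheory GRing.Theory Num.Theory.
Local Open Scope classical_set_scope.
Local Open Scope ring_scope.

(** The numerical range of any matrix over [K(i)] is convex (Toeplitz-Hausdorff),
    so [S] can always be taken to be the hull of [a] and [b]. Let [u] and [v] be
    unit vectors realizing [a] and [b]; normalize by an affine map so that
    [a = 0], [b = 1]. A value [t] strictly between [0] and [1] is reached at a
    multiple of [w = u + r z v], where [z] in [L] is chosen to make the cross
    terms of [<w, M w>] real. The condition [<w, M w> = t <w, w>] is then a
    quadratic equation in [r] over [K] whose leading and constant coefficients
    have opposite signs, hence it is solvable using only square roots of
    positive elements. *)

(* The library proves that [conjc] is a ring morphism only over an [rcfType]. *)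
Lemma conjcD_realField (K : realFieldType) (x y : K[i]) :
  conjc (x + y) = conjc x + conjc y.
Proof. by case: x y => [a b] [c d]; apply/eqP; rewrite eq_complex /= opprD !eqxx. Qed.

Lemma conjcM_realField (K : realFieldType) (x y : K[i]) :
  conjc (x * y) = conjc x * conjc y.
Proof.
case: x y => [a b] [c d]; apply/eqP; rewrite eq_complex /=.
by apply/andP; split; apply/eqP; ring.
Qed.

Lemma conjcK_realField (K : realFieldType) (x : K[i]) : conjc (conjc x) = x.
Proof. by case: x => a b /=; rewrite opprK. Qed.

Lemma mul_conjc_sqr (K : realFieldType) (x : K[i]) :
  conjc x * x = real_complex K (complex.Re x ^+ 2 + complex.Im x ^+ 2).
Proof.
case: x => a b; apply/eqP; rewrite eq_complex /=.
by apply/andP; split; apply/eqP; ring.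
Qed.

(** Applied to a hull parameter [s] and to [1 - s], this places [s] in the interval from 0 to 1 of
    [K]. *)
Lemma Delta_ge0 (K : realFieldType) (t : K[i]) :
  Delta K t -> exists2 c : K, 0 <= c & t = real_complex K c.
Proof.
move=> [z _ <-]; exists (complex.Re z ^+ 2 + complex.Im z ^+ 2).
  by rewrite addr_ge0 ?sqr_ge0.
by rewrite mulrC mul_conjc_sqr.
Qed.

Lemma hform_scale (K : realFieldType) (n : nat) (c : K[i]) (u v : 'cV[K[i]]_n) :
  hform (c *: u) (c *: v) = conjc c * c * hform u v.
Proof.
rewrite /hform mulr_sumr; apply: eq_bigr => j _.
by rewrite !mxE conjcM_realField mulrACA.
Qed.

Lemma hform_conj (K : realFieldType) (n : nat) (u v : 'cV[K[i]]_n) :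
  hform v u = conjc (hform u v).
Proof.
rewrite /hform (big_morph conjc (@conjcD_realField K) (id1 := 0)); last first.
  by apply/eqP; rewrite eq_complex /= oppr0 !eqxx.
by apply: eq_bigr => j _; rewrite conjcM_realField conjcK_realField mulrC.
Qed.

Lemma hform_quad (K : realFieldType) (n : nat) (M : 'M[K[i]]_n)
    (u v : 'cV[K[i]]_n) (c : K[i]) :
  hform (u + c *: v) (M *m (u + c *: v)) =
  hform u (M *m u) + c * hform u (M *m v) + conjc c * hform v (M *m u)
    + conjc c * c * hform v (M *m v).
Proof.
rewrite mulmxDr -scalemxAr /hform !mulr_sumr -!big_split /=.
apply: eq_bigr => j _; rewrite !mxE conjcD_realField conjcM_realField.
by ring.
Qed.

Lemma hform_sumsq (K : realFieldType) (n : nat) (u : 'cV[K[i]]_n) :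
  hform u u =
  real_complex K (\sum_(j < n) (complex.Re (u j 0) ^+ 2 + complex.Im (u j 0) ^+ 2)).
Proof.
by rewrite /hform raddf_sum; apply: eq_bigr => j _; rewrite mul_conjc_sqr.
Qed.

Lemma hform_gt0 (K : realFieldType) (n : nat) (u : 'cV[K[i]]_n) :
  u != 0 -> exists2 N : K, 0 < N & hform u u = real_complex K N.
Proof.
move=> u0; rewrite hform_sumsq; eexists; last by [].
have sq_ge0 (j : 'I_n) :
    0 <= complex.Re (u j 0) ^+ 2 + complex.Im (u j 0) ^+ 2.
  by rewrite addr_ge0 ?sqr_ge0.
rewrite lt_def sumr_ge0 ?andbT //; apply: contra u0.
rewrite psumr_eq0 // => /allP u_eq0; apply/eqP/colP => j.
have /= := u_eq0 j (mem_index_enum j); rewrite mxE.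
rewrite paddr_eq0 ?sqr_ge0 // !sqrf_eq0 => /andP[/eqP re0 /eqP im0].
by apply/eqP; rewrite eq_complex re0 im0 /= !eqxx.
Qed.

Section PositivesAreSquares.
Variables (K : realFieldType).
Hypothesis sqrtK : forall x : K, 0 < x -> exists y : K, x = y ^+ 2.

(** The reduced discriminant [c ^+ 2 + p * q] is positive, hence a square, and the quadratic formula
    applies. *)
Lemma quadratic_root (p c q : K) :
  0 < p -> 0 < q -> exists r : K, p * r ^+ 2 + 2 * c * r - q = 0.
Proof.
move=> p0 q0; have pn0 : p != 0 by rewrite gt_eqF.
have [|s sE] := sqrtK (c ^+ 2 + p * q).
  by rewrite ltr_wpDl ?sqr_ge0 ?mulr_gt0.
exists ((s - c) / p).
have -> : p * ((s - c) / p) ^+ 2 + 2 * c * ((s - c) / p) - q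
          = (s ^+ 2 - (c ^+ 2 + p * q)) / p by field.
by rewrite -sE subrr mul0r.
Qed.

(* [z = (q1 - p1) + i (p2 + q2)] makes [z P + z^* Q] real; when it vanishes
   the sum is already real for [z = 1]. *)
Lemma real_cross_term (P Q : K[i]) :
  exists2 z : K[i], z != 0 & complex.Im (z * P + conjc z * Q) = 0.
Proof.
case: P Q => [p1 p2] [q1 q2].
have [/eqP|zn0] :=
    eqVneq (Complex (q1 - p1) (p2 + q2)) (0 : K[i]).
  rewrite eq_complex /= => /andP[/eqP h1 /eqP h2].
  by exists 1; rewrite ?oner_neq0 //= !mul1r oppr0 !mul0r !addr0.
by exists (Complex (q1 - p1) (p2 + q2)) => //=; ring.
Qed.

(** For unit vectors [u], [v] with normalized values 0 and 1, cross terms [P], [Q] and [G] = <u,v>,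
    this is <w,Mw> = t <w,w> for w = u + z v. *)
Lemma interpolating_coefficient (P Q G : K[i]) (t : K) : 0 < t < 1 ->
  exists z : K[i], z * P + conjc z * Q + conjc z * z =
    real_complex K t * (1 + z * G + conjc z * conjc G + conjc z * z).
Proof.
move=> /andP[t0 t1]; have [z zn0 imz] := real_cross_term P Q.
set m := complex.Re z ^+ 2 + complex.Im z ^+ 2.
have m0 : 0 < m.
  rewrite lt_def addr_ge0 ?sqr_ge0 // andbT; apply: contra zn0.
  by rewrite paddr_eq0 ?sqr_ge0 // !sqrf_eq0 eq_complex.
pose h := complex.Re (z * P + conjc z * Q).
pose g := complex.Re (z * G).
have lead_gt0 : 0 < (1 - t) * m by rewrite mulr_gt0 ?subr_gt0.
(* With [r * z] as coefficient, the goal becomes (1 - t) m r^2 + (h - 2 t g) r - t = 0. *)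
have [r rE] := quadratic_root _ (h / 2 - t * g) _ lead_gt0 t0.
have crossE : z * P + conjc z * Q = real_complex K h.
  by apply/eqP; rewrite eq_complex imz /h /= !eqxx.
have gE : z * G + conjc z * conjc G = real_complex K (2 * g).
  rewrite -conjcM_realField /g; case: (z * G) => x y.
  by apply/eqP; rewrite eq_complex /= subrr eqxx andbT; apply/eqP; ring.
exists (real_complex K r * z).
have conjr : conjc (real_complex K r * z) = real_complex K r * conjc z.
  rewrite conjcM_realField; congr (_ * _).
  by apply/eqP; rewrite eq_complex /= oppr0 !eqxx.
rewrite conjr.
(* Grouping both sides by powers of [r] leaves only coefficients from [K], so the equation descends
   to [K]. *)
have -> : real_complex K r * z * P + real_complex K r * conjc z * Q
    + real_complex K r * conjc z * (real_complex K r * z)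
  = real_complex K r * (z * P + conjc z * Q)
    + real_complex K r ^+ 2 * (conjc z * z) by ring.
have -> : 1 + real_complex K r * z * G + real_complex K r * conjc z * conjc G
    + real_complex K r * conjc z * (real_complex K r * z)
  = 1 + real_complex K r * (z * G + conjc z * conjc G)
    + real_complex K r ^+ 2 * (conjc z * z) by ring.
rewrite crossE gE mul_conjc_sqr -/m.
rewrite -(rmorph1 (real_complex K)) -!rmorphXn -!rmorphM -!rmorphD -!rmorphM.
congr (real_complex K _).
apply/eqP; rewrite -subr_eq0; apply/eqP; rewrite -[RHS]rE.
by field.
Qed.

(** <w,w> is a positive element of [K], hence some k^2, and w / k is a unit vector with value
    [c]. *)
Lemma numrange_rayleigh (n : nat) (M : 'M[K[i]]_n) (w : 'cV[K[i]]_n) (c : K[i]) :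
  w != 0 -> hform w (M *m w) = c * hform w w -> numrange M c.
Proof.
move=> /hform_gt0[N N0 wN] wM; have [k kN] := sqrtK N N0.
have kk : conjc (real_complex K k^-1) * real_complex K k^-1
          = (real_complex K N)^-1.
  rewrite mul_conjc_sqr /= expr0n addr0 exprVn -kN.
  exact: (fmorphV (real_complex K)).
have Nn0 : real_complex K N != 0.
  by rewrite (fmorph_eq0 (real_complex K)) gt_eqF.
exists (real_complex K k^-1 *: w) => /=.
  by rewrite hform_scale kk wN mulVf.
by rewrite -scalemxAr hform_scale kk wM wN mulrCA mulVf ?mulr1.
Qed.

Lemma numrange_convex (n : nat) (M : 'M[K[i]]_n) (a b : K[i]) :
  numrange M a -> numrange M b -> Delta_hull a b `<=` numrange M.
Proof.
move=> Ma Mb _ [_ [/Delta_ge0[s s0 ->] [_ /Delta_ge0[t t0 ->] ts]] <-].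
have {}ts : s = 1 - t.
  by move: ts => /(congr1 (@complex.Re K)).
have sC : real_complex K s = 1 - real_complex K t by rewrite ts rmorphB rmorph1.
have [ab|ab] := eqVneq a b.
  by rewrite ab -mulrDl addrC subrK mul1r.
(* The endpoints [b] (s = 0) and [a] (t = 0) are split off, as the quadratic needs 0 < t < 1. *)
move: s0; rewrite le_eqVlt => /predU1P[s00|s0].
  by rewrite -s00 rmorph0 mul0r add0r subr0 mul1r.
move: t0; rewrite le_eqVlt => /predU1P[t00|t0].
  by rewrite sC -t00 rmorph0 subr0 subrr mul1r mul0r addr0.
have [u /= uu ua] := Ma; have [v /= vv vb] := Mb.
have ban0 : b - a != 0 by rewrite subr_eq0 eq_sym.
(* The first two arguments are the cross terms of the normalized matrix (M - a) / (b - a). *)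
have [|z zE] := interpolating_coefficient
  ((hform u (M *m v) - a * hform u v) / (b - a))
  ((hform v (M *m u) - a * hform v u) / (b - a)) (hform u v) t.
  by rewrite t0 /= -subr_gt0 -ts.
apply: (numrange_rayleigh _ _ (u + z *: v)).
  (* If w = 0 then u = -z v; both being unit vectors, z has norm 1, and [u] and [v] give the same
     value, so a = b. *)
  apply: contra ab; rewrite addr_eq0 -scaleNr => /eqP uE.
  have := ua; rewrite uE -scalemxAr hform_scale vb.
  by have := uu; rewrite uE hform_scale vv mulr1 => ->; rewrite mul1r => ->.
have wwE : hform (u + z *: v) (u + z *: v) =
    1 + z * hform u v + conjc z * hform v u + conjc z * z.
  by have := hform_quad _ _ 1%:M u v z; rewrite !mul1mx uu vv mulr1.
rewrite -hform_conj -wwE in zE.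
rewrite hform_quad ua vb sC.
(* Undoing the normalization: the hull point is a + (b - a) t. *)
have -> : ((1 - real_complex K t) * a + (1 - (1 - real_complex K t)) * b)
            * hform (u + z *: v) (u + z *: v)
  = a * hform (u + z *: v) (u + z *: v)
    + (b - a) * (real_complex K t * hform (u + z *: v) (u + z *: v)) by ring.
by rewrite -zE wwE; field.
Qed.

End PositivesAreSquares.

Theorem proposition2 (K : realFieldType)
  (sqrtK : forall x : K, 0 < x -> exists y : K, x = y ^+ 2)
  (n : nat) (n_gt0 : (0 < n)%N) (M : 'M[K]_n) (a b : K[i])
  (Ma : numrange (mxL M) a) (Mb : numrange (mxL M) b) (neq_ab : a != b) :
  exists S : set K[i],
    [/\ S `<=` numrange (mxL M), S a, S b &
        S = Delta_hull a b \/
        exists e f : K[i],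
          f != 0 /\ is_Delta_ellipse [set (z - e) / f | z in S]].
Proof.
(* The map s -> 1 - s swaps 0 and 1, so both are hull parameters; they give [b] and [a]. *)
have Delta0 : Delta K 0 by exists 0 => //; rewrite mul0r.
have Delta1 : Delta K 1.
  by exists 1 => //; apply/eqP; rewrite mul1r eq_complex /= oppr0 !eqxx.
exists (Delta_hull a b); split; last by left.
- exact: numrange_convex.
- exists 1; first by split => //; exists 0 => //; rewrite subr0.
  by rewrite subrr mul1r mul0r addr0.
- exists 0; first by split => //; exists 1 => //; rewrite subrr.
  by rewrite subr0 mul1r mul0r add0r.
Qed.
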